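(* Let $n\ge 1$ be an integer and let $f:\mathbb{R}\to\mathbb{R}$ be a continuous function such that $$\det\left[\begin{array}{cccc} f(x) & f(x+h) & \cdots & f(x+nh)\\ f(x+h) & f(x+2h) & \cdots & f(x+(n+1)h)\\ \vdots & \vdots & \ddots & \vdots\\ f(x+nh) & f(x+(n+1)h) & \cdots & f(x+2nh) \end{array}\right]=0\quad\text{for all } x,h\in\mathbb{R}.$$ Then $f$ is an exponential polynomial.
   Context: An exponential polynomial on $\mathbb{R}$ is a function that is a finite complex linear combination of functions $x^{k}e^{\lambda x}$ with $k\in\mathbb{N}$ (with $0\in\mathbb{N}$) and $\lambda\in\mathbb{C}$. The matrix is the $(n+1)\times(n+1)$ matrix whose $(i,j)$ entry is $f(x+(i+j)h)$, $0\le i,j\le n$. *)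

(* Defs.v *)
From mathcomp Require Import all_boot all_order all_algebra.
From mathcomp Require Import complex.
From mathcomp Require Import all_classical all_reals all_analysis.

Set Implicit Arguments.
Unset Strict Implicit.
Unset Printing Implicit Defensive.

Import Order.TTheory GRing.Theory Num.Theory.
Import numFieldNormedType.Exports.

Local Open Scope ring_scope.
Local Open Scope complex_scope.

(* e^(a + ib) = e^a (cos b + i sin b), from the real exp, cos and sin *)
Definition cexp (R : realType) (z : R[i]) : R[i] :=
  (expR (complex.Re z))%:C * (cos (complex.Im z) +i* sin (complex.Im z)).

(* The frequencies [l j] need not be distinct, and [m = 0] gives [g = 0]. *)
Definition exponential_polynomial (R : realType) (g : R -> R[i]) : Prop :=
  exists (m : nat) (c : 'I_m -> R[i]) (k : 'I_m -> nat) (l : 'I_m -> R[i]),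
    forall x : R, g x = \sum_(j < m) c j * x%:C ^+ k j * cexp (l j * x%:C).

Definition hankel_mx (R : realType) (n : nat) (f : R -> R) (x h : R) :
    'M[R]_n.+1 :=
  \matrix_(i < n.+1, j < n.+1) f (x + (i + j)%N%:R * h).

(* Main.v *)
Require Import Defs.
From mathcomp Require Import all_boot all_order all_algebra.
From mathcomp Require Import complex.
From mathcomp Require Import all_classical all_reals all_analysis.
From mathcomp Require Import ring lra zify.
Set Implicit Arguments.
Unset Strict Implicit.
Unset Printing Implicit Defensive.
Import Order.TTheory GRing.Theory Num.Theory.
Import numFieldNormedType.Exports.
Local Open Scope ring_scope.
Local Open Scope complex_scope.

(* For a fixed step h, the sequence f (k h), k in Z, has vanishing Hankel
   determinants of size n+1 at all positions; being bi-infinite, it then obeys a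
   linear recurrence of some order m <= n, so that all its minors
   det (f ((a_i + b_j) h)) of size n+1 vanish, not only the consecutive ones.
   Letting h tend to 0, continuity gives det (f (a_i + b_j)) = 0 for all real
   a_i, b_j.  Choosing a nonsingular minor E of maximal size, the row
   r x = (f (x + b_j))_j satisfies f (x + y) = r x E^-1 (f (a_i + y))_i.
   Integrating in y shows that f is differentiable, and differentiating in y
   that r' = r B for a constant matrix B.  Over R[i], Cayley-Hamilton reduces this
   system to successive equations g' = l g + e with e an exponential polynomial. *)

(** * Hankel minors of bi-infinite sequences *)

Section IntegerSequences.
Variables (F : fieldType) (u : int -> F).
Implicit Types (c d : nat -> F) (m : nat) (p q : int).

(** Coefficients are indexed by all of [nat], so that one [c] serves at orders [m] and [m.+1] and
    can be shifted; values from index [m] on are ignored. *)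
Definition recsum c m q : F := \sum_(i < m) c i * u (q + i%:Z).

Definition hankel_seq m p : 'M[F]_m := \matrix_(i, j) u (p + (i + j)%N%:Z).

(** Invertibility of [hankel_seq m p], as triviality of its left kernel. *)
Definition nonsing m p := forall c,
  (forall j, (j < m)%N -> recsum c m (p + j%:Z) = 0) ->
  forall i, (i < m)%N -> c i = 0.

Lemma mul_hankel_seq c m p (j : 'I_m) :
  ((\row_i c i) *m hankel_seq m p) 0 j = recsum c m (p + (j : nat)%:Z).
Proof.
rewrite mxE; apply: eq_bigr => i _; rewrite !mxE; congr (_ * u _); lia.
Qed.

Lemma hankel_seq_kernel m p : \det (hankel_seq m p) = 0 ->
  exists2 c, (exists2 i, (i < m)%N & c i != 0) &
    forall j, (j < m)%N -> recsum c m (p + j%:Z) = 0.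
Proof.
move=> /eqP/det0P[v v0 vH].
have [k vk] : exists k, v 0 k != 0 by apply/rV0Pn.
pose c i := if insub i is Some k then v 0 k else 0.
have cE (i : 'I_m) : c i = v 0 i by rewrite /c valK.
exists c; first by exists k; rewrite // cE.
move=> j jm.
have -> : recsum c m (p + j%:Z) = (v *m hankel_seq m p) 0 (Ordinal jm).
  rewrite -(mul_hankel_seq c p (Ordinal jm)); congr ((_ *m _) _ _).
  by apply/rowP => i; rewrite mxE cE.
by rewrite vH mxE.
Qed.

Lemma det_hankel_seq_neq0 m p : \det (hankel_seq m p) != 0 -> nonsing m p.
Proof.
move=> H c Hc i im; apply/eqP/negPn/negP => ci0; move/negP: H; apply.
apply/det0P; exists (\row_i c i).
  by apply/rV0Pn; exists (Ordinal im); rewrite mxE.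
by apply/rowP => j; rewrite mul_hankel_seq Hc // mxE.
Qed.

Lemma recsum_recr c m q :
  recsum c m.+1 q = recsum c m q + c m * u (q + m%:Z).
Proof. by rewrite /recsum big_ord_recr. Qed.

Lemma recsum_recl c m q :
  recsum c m.+1 q = c 0%N * u q + recsum (fun i => c i.+1) m (q + 1).
Proof.
rewrite /recsum big_ord_recl /= addr0; congr (_ + _).
by apply: eq_bigr => i _; congr (_ * u _); rewrite /bump /=; lia.
Qed.

(** Both sides are the double sum of [c i * d j * u (q + i + j)]. This symmetry lets a relation [c]
    be pushed through a relation [d]. *)
Lemma recsum_exchange c d m q :
  \sum_(i < m) c i * recsum d m (q + i%:Z) =
  \sum_(j < m) d j * recsum c m (q + j%:Z).
Proof.
rewrite /recsum; under eq_bigr do rewrite mulr_sumr.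
rewrite exchange_big /=; apply: eq_bigr => j _; rewrite mulr_sumr.
by apply: eq_bigr => i _; rewrite mulrCA; congr (_ * (_ * u _)); ring.
Qed.

Lemma recsum_lin c d (s t : F) m q :
  recsum (fun i => s * c i - t * d i) m q = s * recsum c m q - t * recsum d m q.
Proof.
rewrite /recsum !mulr_sumr -sumrB; apply: eq_bigr => i _; ring.
Qed.

Section Recurrence.
Variable m : nat.
Hypothesis det0 : forall p, \det (hankel_seq m.+1 p) = 0.

(** Without its last coefficient, [c] is a left kernel vector of the nonsingular block at [p]. *)
Lemma recsum_last0 c p : nonsing m p ->
    (forall j, (j < m)%N -> recsum c m.+1 (p + j%:Z) = 0) -> c m = 0 ->
  forall i, (i <= m)%N -> c i = 0.
Proof.
move=> ns Hc cm i; rewrite leq_eqVlt => /predU1P[->//|]; apply: ns => j jm.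
by have := Hc j jm; rewrite recsum_recr cm mul0r addr0.
Qed.

(** Dropping a zero first coefficient moves the sums from [p - 1] to [p], where the block is
    nonsingular. *)
Lemma recsum_head0 c p : nonsing m p ->
    (forall j, (j < m)%N -> recsum c m.+1 (p - 1 + j%:Z) = 0) -> c 0%N = 0 ->
  forall i, (i <= m)%N -> c i = 0.
Proof.
move=> ns Hc c0 [|i] im //; apply: (ns (fun i => c i.+1)) => // j jm.
have := Hc j jm; rewrite recsum_recl c0 mul0r add0r => <-.
by congr recsum; ring.
Qed.

(** The second half puts [c] in the left kernel of the Hankel matrix of size m+1 at [p - 1]. The
    pair is the invariant carried along Z in both directions. *)
Definition rec_at c p :=
  nonsing m p /\ forall j, (j <= m)%N -> recsum c m.+1 (p - 1 + j%:Z) = 0.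

(* The m x m block at p sits in the Hankel matrix of size m+1 at p-1 both as rows
   0..m-1 of columns 1..m and as rows 1..m of columns 0..m-1, so a kernel vector of
   the latter can vanish at neither end. *)
Lemma rec_at_ex p : nonsing m p ->
  exists c, [/\ c 0%N != 0, c m != 0 & rec_at c p].
Proof.
move=> ns; have [c [i im ci] Hc] := hankel_seq_kernel (det0 (p - 1)).
exists c; split=> //; apply/eqP => c0; case/eqP: ci.
  by apply: (recsum_head0 ns _ c0) => // j jm; apply: Hc; lia.
apply: (recsum_last0 ns _ c0) => // j jm.
have -> : p + j%:Z = p - 1 + j.+1%:Z by lia.
by apply: Hc.
Qed.

(** Since [c 0] is nonzero, the recurrence writes each [u (p + i)] through the next [m] terms, so a
    relation on the block at [p + 1] extends back to the block at [p] and is trivial. *)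
Lemma rec_at_next c p : c 0%N != 0 -> c m != 0 ->
  rec_at c p -> rec_at c (p + 1).
Proof.
move=> c0 cm [ns Hc].
have Hc' j : (j < m)%N -> recsum c m.+1 (p + j%:Z) = 0.
  move=> jm; have -> : p + j%:Z = p - 1 + j.+1%:Z by lia.
  exact: Hc.
split.
  move=> d Hd; apply: ns => -[|j] jm; last first.
    have -> : p + j.+1%:Z = p + 1 + j%:Z by lia.
    by apply: Hd; lia.
  apply: (mulfI c0); rewrite mulr0 addr0 /recsum mulr_sumr.
  transitivity (- \sum_(i < m) d i *
                    recsum (fun i => c i.+1) m (p + 1 + i%:Z)); last first.
    rewrite recsum_exchange big1 ?oppr0 // => i _.
    by rewrite Hd ?mulr0.
  rewrite -sumrN; apply: eq_bigr => i _.
  have /eqP := Hc' i (ltn_ord i).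
  rewrite recsum_recl addrAC addr_eq0 mulrCA => /eqP ->.
  by rewrite mulrN.
(* Only the sum at [p + m] is new. A kernel vector [d] at [p] is proportional to [c], because
   [c m * d - d m * c] has last coefficient 0; hence [c] inherits this last relation from [d]. *)
move=> j; rewrite leq_eqVlt addrK => /predU1P[->|]; last exact: Hc'.
have [d [i im di] Hd] := hankel_seq_kernel (det0 p).
pose e i := c m * d i - d m * c i.
have e0 : forall i, (i <= m)%N -> e i = 0.
  apply: (recsum_last0 ns); last by rewrite /e; ring.
  move=> k km; rewrite recsum_lin Hc' // Hd; last by lia.
  ring.
have dm : d m != 0.
  apply/eqP => dm; case/eqP: di; apply: (mulfI cm).
  by have := e0 i im; rewrite /e dm => /eqP; rewrite subr_eq0 => /eqP ->; ring.
apply: (mulfI dm); rewrite mulr0.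
have := recsum_lin d c (c m) (d m) m.+1 (p + m%:Z).
rewrite Hd // mulr0 sub0r => H; apply/eqP; rewrite -oppr_eq0 -H.
by apply/eqP/big1 => k _; rewrite -/(e k) e0 ?mul0r // -ltnS.
Qed.

(** Mirror image of [rec_at_next]: solving for the last term uses [c m], and proportionality is
    tested on the first coefficient. *)
Lemma rec_at_prev c p : c 0%N != 0 -> c m != 0 ->
  rec_at c p -> rec_at c (p - 1).
Proof.
move=> c0 cm [ns Hc]; split.
  move=> d Hd; apply: ns => j jm.
  have [jm1|jm1] := ltnP j.+1 m.
    have -> : p + j%:Z = p - 1 + j.+1%:Z by lia.
    by apply: Hd.
  apply: (mulfI cm); rewrite mulr0 /recsum mulr_sumr.
  transitivity (- \sum_(i < m) d i * recsum c m (p - 1 + i%:Z)); last first.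
    rewrite recsum_exchange big1 ?oppr0 // => i _.
    by rewrite Hd ?mulr0.
  rewrite -sumrN; apply: eq_bigr => i _.
  have /eqP := Hc i (ltnW (ltn_ord i)).
  rewrite recsum_recr addrC addr_eq0 mulrCA => /eqP.
  have -> : p - 1 + i%:Z + m%:Z = p + j%:Z + i%:Z by lia.
  by move=> ->; rewrite mulrN.
move=> [_|j jm]; last first.
  have -> : p - 1 - 1 + j.+1%:Z = p - 1 + j%:Z by lia.
  by apply: Hc; lia.
have [d [i im di] Hd] := hankel_seq_kernel (det0 (p - 1 - 1)).
pose e i := c 0%N * d i - d 0%N * c i.
have e0 : forall i, (i <= m)%N -> e i = 0.
  apply: (recsum_head0 ns); last by rewrite /e; ring.
  move=> k km; rewrite recsum_lin Hc; last by lia.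
  have -> : p - 1 + k%:Z = p - 1 - 1 + k.+1%:Z by lia.
  by rewrite Hd //; ring.
have dm : d 0%N != 0.
  apply/eqP => dm; case/eqP: di; apply: (mulfI c0).
  by have := e0 i im; rewrite /e dm => /eqP; rewrite subr_eq0 => /eqP ->; ring.
apply: (mulfI dm); rewrite mulr0.
have := recsum_lin d c (c 0%N) (d 0%N) m.+1 (p - 1 - 1 + 0%N%:Z).
rewrite Hd // mulr0 sub0r => H; apply/eqP; rewrite -oppr_eq0 -H.
by apply/eqP/big1 => k _; rewrite -/(e k) e0 ?mul0r // -ltnS.
Qed.

Lemma recurrence_of_nonsing p0 : nonsing m p0 ->
  exists2 c, c m != 0 & forall q, recsum c m.+1 q = 0.
Proof.
move=> /rec_at_ex[c [c0 cm Hp]]; exists c => // q.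
suff H k : rec_at c (p0 + k).
  (* The relations of [rec_at] start one place before its position, so position [q + 1] yields the
     relation at [q]. *)
  have [_ /(_ 0%N isT)] := H (q + 1 - p0).
  by move=> <-; congr recsum; ring.
elim/int_ind: k => [|k IH|k IH]; first by rewrite addr0.
  have -> : p0 + k.+1%:Z = p0 + k%:Z + 1 by lia.
  exact: rec_at_next.
have -> : p0 - k.+1%:Z = p0 - k%:Z - 1 by lia.
exact: rec_at_prev.
Qed.

End Recurrence.

(** The coefficients [d] are those of X^b reduced modulo the polynomial with coefficients [c]; they
    do not depend on [q]. *)
Lemma recurrence_shift m c : c m != 0 -> (forall q, recsum c m.+1 q = 0) ->
  forall b, exists d, forall q, u (q + b%:Z) = recsum d m q.
Proof.
case: m => [|m] cm Hc.
  move=> b; exists (fun=> 0) => q; have /eqP := Hc (q + b%:Z).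
  rewrite recsum_recr /recsum !big_ord0 add0r addr0 mulf_eq0 (negPf cm) /=.
  by move/eqP.
elim=> [|b [d Hd]].
  exists (fun i => (i == 0%N)%:R) => q.
  by rewrite recsum_recl mul1r addr0 /recsum big1 ?addr0 // => i _; rewrite mul0r.
(* [d'] is [d] multiplied by X; subtracting a multiple of [c] cancels its term of index [m.+1]. *)
pose d' i := if i is j.+1 then d j else 0.
exists (fun i => 1 * d' i - d m / c m.+1 * c i) => q.
have -> : q + b.+1%:Z = q + 1 + b%:Z by lia.
rewrite Hd recsum_lin mul1r.
have := Hc q; rewrite recsum_recr => /eqP; rewrite addr_eq0 => /eqP ->.
have : recsum d' m.+2 q = recsum d m.+1 (q + 1).
  by rewrite recsum_recl mul0r add0r.
rewrite recsum_recr => <-; rewrite [d' m.+1]/=.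
by field.
Qed.

End IntegerSequences.

(** A recurrence of order m <= n makes the matrix factor through dimension m, so its rank is less
    than n+1. *)
Lemma det_hankel_minor (F : fieldType) (u : int -> F) n :
    (forall p, \det (hankel_seq u n.+1 p) = 0) ->
  forall a b : 'I_n.+1 -> int, \det (\matrix_(i, j) u (a i + b j)) = 0.
Proof.
move=> det0 a b.
(* [m] is the largest size, at most [n], with a nonzero Hankel determinant; it exists because the
   empty determinant is 1. *)
have [m mn [det0m [p Hp]]] : exists2 m, (m <= n)%N &
    (forall p, \det (hankel_seq u m.+1 p) = 0) /\
    exists p, \det (hankel_seq u m p) != 0.
  elim: n det0 {a b} => [|n IH] det0.
    by exists 0%N => //; split=> //; exists 0; rewrite det_mx00 oner_eq0.
  have [Hn|Hn] := pselect (exists p, \det (hankel_seq u n.+1 p) != 0).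
    by exists n.+1.
  have [|m mn Hm] := IH; last by exists m => //; exact: leqW.
  by move=> p; apply/eqP/negPn/negP => Hp; apply: Hn; exists p.
have [c cm Hc] := recurrence_of_nonsing det0m (det_hankel_seq_neq0 Hp).
have /choice[d Hd] := recurrence_shift cm Hc.
(* Shifting by N makes all column indices natural numbers. *)
pose N := (\sum_j absz (b j))%N.
have bN j : exists k : nat, b j = k%:Z - N%:Z.
  exists (absz (b j + N%:Z)); have : (absz (b j) <= N)%N by rewrite /N (bigD1 j) //= leq_addr.
  lia.
have {bN}/choice[k Hk] := bN.
pose X : 'M[F]_(n.+1, m) := \matrix_(i, l) u (a i - N%:Z + (l : nat)%:Z).
pose Y : 'M[F]_(m, n.+1) := \matrix_(l, j) d (k j) l.
have -> : \matrix_(i, j) u (a i + b j) = X *m Y.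
  apply/matrixP => i j; rewrite !mxE Hk.
  have -> : a i + ((k j)%:Z - N%:Z) = a i - N%:Z + (k j)%:Z by ring.
  by rewrite Hd; apply: eq_bigr => l _; rewrite !mxE mulrC.
apply/eqP; apply/negPn/negP => det_neq0.
have : X *m Y \in unitmx by rewrite unitmxE unitfE.
rewrite -row_full_unit -col_leq_rank => /leq_trans/(_ (mulmx_max_rank X Y)).
lia.
Qed.

(** * From consecutive minors to all minors *)

Section RealTranslates.
Local Open Scope classical_set_scope.

Lemma cvg_det (R : realType) n (T : Type) (F : set_system T) (FF : Filter F)
    (A : T -> 'M[R]_n) (L : 'M[R]_n) :
    (forall i j, A t i j @[t --> F] --> L i j) ->
  \det (A t) @[t --> F] --> \det L.
Proof.
move=> AL; rewrite /determinant.
apply: (@cvg_big R _ +%R 0 xpredT); first exact: add_continuous.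
move=> s _.
apply: cvgM; first exact: cvg_cst.
apply: (@cvg_big R _ *%R 1 xpredT); first exact: mul_continuous.
by move=> i _; exact: AL.
Qed.

Lemma cvg_floor_frac (R : realType) (x : R) :
  (Num.floor (x * k.+1%:R))%:~R / k.+1%:R @[k --> \oo] --> x.
Proof.
apply/cvgrPdist_le => /= e e0; near=> k.
have k0 : (0 : R) < k.+1%:R by rewrite ltr0n.
have ke : k.+1%:R^-1 <= e.
  near: k; have /cvgrPdist_le/(_ _ e0) := @cvg_harmonic R.
  by apply: filterS => k; rewrite sub0r normrN ger0_norm ?harmonic_ge0.
apply: le_trans ke; rewrite -[x in x - _](mulfK (lt0r_neq0 k0)) -mulrBl.
have ki : (0 : R) <= k.+1%:R^-1 by rewrite invr_ge0 ltW.
rewrite normrM [`|_^-1|]ger0_norm // ler_piMl //.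
rewrite ger0_norm ?subr_ge0 ?floor_le_tmp // lerBlDr addrC.
by have := ltW (floorD1_gt (x * k.+1%:R)); rewrite intrD addrC.
Unshelve. all: by end_near. Qed.

(** Rounding each [a i] and [b j] separately to the grid of mesh 1/(k+1) keeps the entries a
    function of a sum of integers, so [det_hankel_minor] applies before the limit is taken. *)
Lemma det_translates (R : realType) n (f : R -> R) : continuous f ->
    (forall x h, \det (hankel_mx n f x h) = 0) ->
  forall a b : 'I_n.+1 -> R, \det (\matrix_(i, j) f (a i + b j)) = 0.
Proof.
move=> fc f0 a b.
pose g (x : R) k : int := Num.floor (x * k.+1%:R).
pose A k : 'M[R]_n.+1 :=
  \matrix_(i, j) f ((g (a i) k + g (b j) k)%:~R / k.+1%:R).
suff A_cvg : \det (A k) @[k --> \oo] --> \det (\matrix_(i, j) f (a i + b j)).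
  suff A0 k : \det (A k) = 0.
    apply: (cvg_unique _ A_cvg); first exact: Rhausdorff.
    by rewrite /= (eq_cvg _ _ A0); exact: cvg_cst.
  apply: (@det_hankel_minor R (fun z => f (z%:~R / k.+1%:R))).
  move=> p; rewrite -[RHS](f0 (p%:~R / k.+1%:R) (k.+1%:R^-1)).
  by congr determinant; apply/matrixP => i j; rewrite !mxE intrD mulrDl.
apply: cvg_det => i j.
have AE k : A k i j = f ((g (a i) k)%:~R / k.+1%:R + (g (b j) k)%:~R / k.+1%:R).
  by rewrite mxE intrD mulrDl.
rewrite mxE (eq_cvg _ _ AE); apply: continuous_cvg; first exact: fc.
by apply: cvgD; exact: cvg_floor_frac.
Qed.

End RealTranslates.

(** * Bordered determinants and finite-rank factorization *)

(** Vanishing of the Schur complement of [E]: a left kernel vector (s, w) has w = - s r E^-1, so s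
    is nonzero, and the first column then determines [x]. *)
Lemma bordered_det0 (F : fieldType) n (x : F) (r : 'rV[F]_n) (c : 'cV[F]_n)
    (E : 'M[F]_n) :
    E \in unitmx -> \det (block_mx x%:M r c E) = 0 ->
  x = (r *m invmx E *m c) 0 0.
Proof.
move=> EU /eqP/det0P[v v0].
rewrite -[v]hsubmxK mul_row_block.
move: (lsubmx v) (rsubmx v) (hsubmxK v) => s w vE; rewrite -row_mx0.
move=> /eq_row_mx[sf sr].
have wE : w = - (s *m r *m invmx E).
  apply: (can_inj (mulmxK EU)); rewrite mulNmx mulmxKV //.
  by apply/eqP; rewrite -addr_eq0 addrC sr.
have s0 : s 0 0 != 0.
  apply: contraNneq v0 => s00; have sz : s = 0.
    by apply/rowP => k; rewrite ord1 s00 mxE.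
  by rewrite -vE wE sz !mul0mx oppr0 row_mx0.
apply: (mulfI s0).
have /matrixP/(_ 0 0) := sf.
rewrite wE mulNmx -!mulmxA [s]mx11_scalar !mul_scalar_mx !mxE eqxx mulr1n.
by move=> /eqP; rewrite subr_eq0 => /eqP ->.
Qed.

(** Bordering a nonsingular minor of maximal size by the row of [x] and the column of [y] gives a
    singular matrix, to which [bordered_det0] applies. The case [m = 0] is that of [f] identically
    zero. *)
Lemma rank_factorization (F : fieldType) (T S : Type) (t0 : T) (s0 : S)
    (f : T -> S -> F) n :
    (forall (a : 'I_n.+1 -> T) (b : 'I_n.+1 -> S),
       \det (\matrix_(i, j) f (a i) (b j)) = 0) ->
  exists m (a : 'I_m -> T) (b : 'I_m -> S),
    let E := \matrix_(i, j) f (a i) (b j) in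
    E \in unitmx /\
    forall x y, f x y =
      ((\row_j f x (b j)) *m invmx E *m (\col_i f (a i) y)) 0 0.
Proof.
elim: n => [|n IH] det0.
  exists 0%N, (fun=> t0), (fun=> s0); split.
    by rewrite unitmxE det_mx00 unitr1.
  move=> x y; rewrite mxE big_ord0.
  by have := det0 (fun=> x) (fun=> y); rewrite det_mx11 mxE.
have [[a [b ab]]|H] := pselect (exists (a : 'I_n.+1 -> T) (b : 'I_n.+1 -> S),
    \det (\matrix_(i, j) f (a i) (b j)) != 0); last first.
  by apply: IH => a b; apply/eqP/negPn/negP => ab; apply: H; exists a, b.
exists n.+1, a, b; set E := (X in \det X != 0) in ab *.
have EU : E \in unitmx by rewrite unitmxE unitfE.
split=> // x y.
set r := \row_j f x (b j); set c := \col_i f (a i) y.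
(* Index 0 carries the new points [x] and [y], to match the layout of [block_mx]. *)
pose a' i := if @fintype.split 1 n.+1 i is inr k then a k else x.
pose b' j := if @fintype.split 1 n.+1 j is inr k then b k else y.
apply: bordered_det0 => //; rewrite -[RHS](det0 a' b'); congr determinant.
transitivity (\matrix_(i < 1 + n.+1, j < 1 + n.+1) f (a' i) (b' j)) => //.
apply/matrixP => i j; rewrite !mxE /a' /b'.
by case: (@fintype.split 1 n.+1 i) => k; rewrite !mxE;
  case: (@fintype.split 1 n.+1 j) => l; rewrite !mxE // !ord1 eqxx mulr1n.
Qed.

(** * The differential equation for the translates *)

Section Differentiability.
Local Open Scope classical_set_scope.

Lemma continuous_primitive (R : realType) (f : R -> R) : continuous f ->
  exists P : R -> R, forall x, is_derive x (1 : R) P (f x).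
Proof.
move=> fc.
pose mu : {measure set (measurableTypeR R) -> \bar R} := lebesgue_measure.
have fint a b : mu.-integrable `[a, b] (EFin \o f).
  apply: continuous_compact_integrable; first exact: segment_compact.
  by move=> x; apply: continuous_subspaceT.
(* One of the two intervals is empty, according to the sign of x. *)
pose P x := \int[mu]_(t in `]0, x]) f t - \int[mu]_(t in `]x, 0]) f t.
(* [B] lies below both 0 and [x0], so near [x0] the function [P] equals the integral from [B] minus
   a constant. *)
exists P => x0; pose B := - `|x0| - 1.
have B0 : B < 0 by rewrite /B; have := normr_ge0 x0; lra.
have Bx0 : B < x0 by rewrite /B; have := lerNnormlW (lexx `|x0|); lra.
pose G x := \int[mu]_(t in `[B, x]) f t.
have Gder : is_derive x0 (1 : R) G (f x0).
  have x01 : x0 < x0 + 1 by rewrite ltrDl.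
  have [dG DG] := continuous_FTC1_closed x01 (fint B _) Bx0 (fc x0).
  by split; rewrite -?derive1E.
have Gsub x y : B <= x -> x <= y -> G y - G x = \int[mu]_(t in `]x, y]) f t.
  by move=> Bx xy; apply: Rintegral_itvB; rewrite ?bnd_simp.
apply: (@near_eq_is_derive _ _ _ (G - cst (G 0))); last first.
  by rewrite -[f x0]subr0; apply: is_deriveB.
near=> x; have Bx : B < x by near: x; exact: lt_nbhsr.
have P0 y z : z <= y -> \int[mu]_(t in `]y, z]) f t = 0.
  by move=> zy; rewrite set_itv_ge ?Rintegral_set0 // bnd_simp -leNgt.
have [x_ge0|x_lt0] := leP 0 x.
  by rewrite /P [X in _ = _ - X]P0 // subr0 -Gsub // ltW.
by rewrite /P [X in _ = X - _]P0 ?(ltW x_lt0) // sub0r -Gsub ?opprB // ltW.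
Unshelve. all: by end_near. Qed.

Section TranslationRank.
Variables (R : realType) (m : nat) (f P : R -> R) (a b : 'I_m -> R).
Hypothesis P_derive : forall x, is_derive x (1 : R) P (f x).
Let E : 'M[R]_m := \matrix_(i, j) f (a i + b j).
Hypothesis E_unit : E \in unitmx.
Let r (x : R) : 'rV[R]_m := \row_j f (x + b j).
Hypothesis f_add : forall x y,
  f (x + y) = (r x *m invmx E *m (\col_i f (a i + y))) 0 0.

Lemma is_derive_comp_shift (g : R -> R) (dg c x : R) :
  is_derive (c + x) (1 : R) g dg -> is_derive x (1 : R) (fun y => g (c + y)) dg.
Proof.
move=> Dg; rewrite -[dg]mulr1.
apply: (@is_derive1_comp _ g (fun y => c + y)) => //.
by rewrite -[X in is_derive _ _ _ X]add0r; apply: (is_deriveD (is_derive_cst c _ _)).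
Qed.

Lemma is_derive_sumM n (c : 'I_n -> R) (h : 'I_n -> R -> R) dh x :
  (forall i, is_derive x (1 : R) (h i) (dh i)) ->
  is_derive x (1 : R) (fun t => \sum_i c i * h i t) (\sum_i c i * dh i).
Proof.
move=> Dh.
rewrite (_ : (fun _ => _) = \sum_i (c i \*: h i)); last first.
  by apply/funext => t; rewrite fct_sumE.
by apply: is_derive_sum => i; exact: is_deriveZ.
Qed.

(** This is [f_add] integrated in [y] from [s] to [t]: the difference [g] of the two primitives has
    derivative 0. *)
Lemma primitive_translate x s t : P (x + t) - P (x + s) =
  (r x *m invmx E *m (\col_i (P (a i + t) - P (a i + s)))) 0 0.
Proof.
set w := r x *m invmx E.
pose g y := P (x + y) - \sum_i w 0 i * P (a i + y).
have Dg y : is_derive y (1 : R) g 0.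
  have fE : f (x + y) = \sum_i w 0 i * f (a i + y).
    by rewrite f_add mxE; apply: eq_bigr => i _; rewrite [X in _ * X]mxE.
  rewrite -(subrr (f (x + y))) {2}fE.
  apply: is_deriveB; first exact: is_derive_comp_shift.
  by apply: is_derive_sumM => i; exact: is_derive_comp_shift.
rewrite mxE; under eq_bigr do rewrite [X in _ * X]mxE mulrBr.
by rewrite sumrB; have := is_derive_0_is_cst t s Dg; rewrite /g; lra.
Qed.

Let ET T : 'M[R]_m := \matrix_(i, j) (P (a i + (b j + T)) - P (a i + b j)).

(* ET T / T tends to E as T tends to 0. *)
Lemma increments_unit : exists T, ET T \in unitmx.
Proof.
have det_cvg : \det (T^-1 *: ET T) @[T --> 0^'] --> \det E.
  apply: cvg_det => i j; rewrite mxE.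
  have [Pder <-] := P_derive (a i + b j).
  suff -> : (fun T => (T^-1 *: ET T) i j) = (fun h : R =>
      h^-1 *: ((P \o shift (a i + b j)) (h *: 1) - P (a i + b j))) by exact: Pder.
  apply/funext => h; rewrite !mxE /= [h%:A]mulr1.
  by rewrite [h + _]addrC addrA.
have detE : 0 < `|\det E| by rewrite normr_gt0 -unitfE -unitmxE.
have : \forall T \near 0^', \det (T^-1 *: ET T) != 0.
  have /cvgrPdist_lt/(_ _ detE) := det_cvg.
  by apply: filterS => T; apply: contraTneq => ->; rewrite subr0 ltxx.
move=> /filter_ex[T]; rewrite detZ mulf_eq0 negb_or => /andP[_ TU].
by exists T; rewrite unitmxE unitfE.
Qed.

(** An invertible [ET T] lets [f] be recovered as a fixed linear combination of increments of the
    differentiable function [P]. *)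
Lemma finite_rank_derivable x : derivable f x 1.
Proof.
have [T TU] := increments_unit.
(* Chosen so that r y E^-1 (ET T) w collapses to r y E^-1 (f (a_i + 0))_i, which is [f y] by
   [f_add]. *)
pose w := invmx (ET T) *m E *m invmx E *m (\col_i f (a i + 0)).
have fE y : f y = \sum_l w l 0 * (P (b l + T + y) - P (b l + y)).
  have rE : (\row_l (P (y + (b l + T)) - P (y + b l))) = r y *m invmx E *m ET T.
    apply/rowP => l; rewrite mxE primitive_translate !mxE.
    by apply: eq_bigr => i _; rewrite !mxE.
  have -> : f y = ((\row_l (P (y + (b l + T)) - P (y + b l))) *m w) 0 0.
    by rewrite rE /w !mulmxA !mulmxK // -f_add addr0.
  rewrite mxE; apply: eq_bigr => l _.
  by rewrite mxE mulrC; congr (_ * (P _ - P _)); ring.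
have -> : f = fun y => \sum_l w l 0 * (P (b l + T + y) - P (b l + y)).
  exact/funext.
apply: (@ex_derive _ _ _ _ _ _ (\sum_l w l 0 * (f (b l + T + x) - f (b l + x)))).
apply: is_derive_sumM => l.
by apply: is_deriveB; exact: is_derive_comp_shift.
Qed.

(** The derivative of [f (x + y)] in [y] at [b j] is computed directly and through [f_add]; equating
    the two gives B = E^-1 (f' (a_i + b_j)). *)
Lemma finite_rank_ode : exists B : 'M[R]_m, forall x j,
  is_derive x (1 : R) (fun t => r t 0 j) ((r x *m B) 0 j).
Proof.
pose g := fun x => 'D_1 f x.
have fD x : is_derive x (1 : R) f (g x) by apply/derivableP/finite_rank_derivable.
exists (invmx E *m \matrix_(i, j) g (a i + b j)) => x j.
have -> : (r x *m (invmx E *m \matrix_(i, j) g (a i + b j))) 0 j = g (b j + x).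
  rewrite mulmxA mxE; under eq_bigr do rewrite [X in _ * X]mxE.
  have D1 : is_derive (b j) (1 : R) (fun y => f (x + y)) (g (x + b j)).
    exact: is_derive_comp_shift.
  have D2 : is_derive (b j) (1 : R) (fun y => f (x + y))
      (\sum_i (r x *m invmx E) 0 i * g (a i + b j)).
    have -> : (fun y => f (x + y)) =
        fun y => \sum_i (r x *m invmx E) 0 i * f (a i + y).
      apply/funext => y; rewrite f_add mxE.
      by apply: eq_bigr => i _; rewrite [X in _ * X]mxE.
    by apply: is_derive_sumM => i; exact: is_derive_comp_shift.
  by rewrite addrC -(@derive_val _ _ _ _ _ _ _ D1) -(@derive_val _ _ _ _ _ _ _ D2).
have -> : (fun t => r t 0 j) = fun t => f (b j + t).
  by apply/funext => t; rewrite mxE addrC.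
exact: is_derive_comp_shift.
Qed.

End TranslationRank.

End Differentiability.

(** * Exponential polynomials *)

Section ComplexDerivative.
Variable R : realType.
Implicit Types (g dg e : R -> R[i]) (l w : R[i]).

(* R[i] carries no normed module structure over R, hence the componentwise derivative. *)
Definition cderive g dg := forall x,
  is_derive x (1 : R) (fun y => complex.Re (g y)) (complex.Re (dg x)) /\
  is_derive x (1 : R) (fun y => complex.Im (g y)) (complex.Im (dg x)).

Lemma cderive_ext g g' dg dg' : g =1 g' -> dg =1 dg' ->
  cderive g dg -> cderive g' dg'.
Proof. by move=> /funext <- /funext <-. Qed.

Lemma cderive_cst w : cderive (fun=> w) (fun=> 0).
Proof. by move=> x; split; exact: is_derive_cst. Qed.

Lemma ReD (u v : R[i]) : complex.Re (u + v) = complex.Re u + complex.Re v.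
Proof. by case: u v => [? ?] [? ?]. Qed.

Lemma ImD (u v : R[i]) : complex.Im (u + v) = complex.Im u + complex.Im v.
Proof. by case: u v => [? ?] [? ?]. Qed.

Lemma ReM (u v : R[i]) : complex.Re (u * v) =
  complex.Re u * complex.Re v - complex.Im u * complex.Im v.
Proof. by case: u v => [? ?] [? ?]. Qed.

Lemma ImM (u v : R[i]) : complex.Im (u * v) =
  complex.Re u * complex.Im v + complex.Im u * complex.Re v.
Proof. by case: u v => [? ?] [? ?]. Qed.

Lemma cderiveD g dg h dh : cderive g dg -> cderive h dh ->
  cderive (fun x => g x + h x) (fun x => dg x + dh x).
Proof.
move=> Dg Dh x; have [Dg1 Dg2] := Dg x; have [Dh1 Dh2] := Dh x.
split; rewrite (ReD, ImD).
  rewrite (_ : (fun y => _) =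
    (fun y => complex.Re (g y)) + (fun y => complex.Re (h y))).
    exact: is_deriveD.
  by apply/funext => y; rewrite ReD.
rewrite (_ : (fun y => _) =
  (fun y => complex.Im (g y)) + (fun y => complex.Im (h y))).
  exact: is_deriveD.
by apply/funext => y; rewrite ImD.
Qed.

Lemma cderiveM g dg h dh : cderive g dg -> cderive h dh ->
  cderive (fun x => g x * h x) (fun x => dg x * h x + g x * dh x).
Proof.
move=> Dg Dh x; have [Dg1 Dg2] := Dg x; have [Dh1 Dh2] := Dh x.
pose reg y := complex.Re (g y); pose img y := complex.Im (g y).
pose reh y := complex.Re (h y); pose imh y := complex.Im (h y).
split.
  rewrite (_ : (fun y => _) = reg * reh - img * imh); last first.
    by apply/funext => y; rewrite ReM.
  apply: is_derive_eq (is_deriveB (is_deriveM Dg1 Dh1) (is_deriveM Dg2 Dh2)) _.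
  by rewrite ReD !ReM /reg /img /reh /imh /GRing.scale /=; ring.
rewrite (_ : (fun y => _) = reg * imh + img * reh); last first.
  by apply/funext => y; rewrite ImM.
apply: is_derive_eq (is_deriveD (is_deriveM Dg1 Dh2) (is_deriveM Dg2 Dh1)) _.
by rewrite ImD !ImM /reg /img /reh /imh /GRing.scale /=; ring.
Qed.

Lemma cderiveZ w g dg : cderive g dg ->
  cderive (fun x => w * g x) (fun x => w * dg x).
Proof.
move=> Dg; apply: cderive_ext (cderiveM (cderive_cst w) Dg) => // x.
by rewrite mul0r add0r.
Qed.

Lemma cderiveB g dg h dh : cderive g dg -> cderive h dh ->
  cderive (fun x => g x - h x) (fun x => dg x - dh x).
Proof.
move=> Dg Dh; apply: cderive_ext (cderiveD Dg (cderiveZ (-1) Dh)) => x;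
  by rewrite mulN1r.
Qed.

Lemma cderive_sum n (g dg : 'I_n -> R -> R[i]) :
  (forall i, cderive (g i) (dg i)) ->
  cderive (fun x => \sum_i g i x) (fun x => \sum_i dg i x).
Proof.
elim: n g dg => [|n IH] g dg Dg.
  by apply: cderive_ext (cderive_cst 0) => x; rewrite big_ord0.
have := cderiveD (IH _ _ (fun i => Dg (widen_ord (leqnSn n) i))) (Dg ord_max).
by apply: cderive_ext => x; rewrite big_ord_recr.
Qed.

Lemma cderive_real (g dg : R -> R) : (forall x, is_derive x (1 : R) g (dg x)) ->
  cderive (fun x => (g x)%:C) (fun x => (dg x)%:C).
Proof. by move=> Dg x; split => //=; exact: is_derive_cst. Qed.

Lemma cderive_powX k :
  cderive (fun x => x%:C ^+ k.+1) (fun x => k.+1%:R * x%:C ^+ k).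
Proof.
elim: k => [|k IH].
  apply: cderive_ext (cderive_real (fun x => is_derive_id x (1 : R))) => x.
    by rewrite expr1.
  by rewrite expr0 mulr1.
have := cderiveM (cderive_real (fun x => is_derive_id x (1 : R))) IH.
apply: cderive_ext => x; first by rewrite -exprS.
by rewrite mul1r mulrCA -exprS -[k.+2%:R]natr1 mulrDl mul1r addrC.
Qed.

Lemma cderive0_cst g : cderive g (fun=> 0) -> forall x, g x = g 0.
Proof.
move=> Dg x.
have Re0 := is_derive_0_is_cst x 0 (fun y => (Dg y).1).
have Im0 := is_derive_0_is_cst x 0 (fun y => (Dg y).2).
by move: Re0 Im0; case: (g x) (g 0) => [? ?] [? ?] /= -> ->.
Qed.

Lemma cexp0 : cexp 0 = 1 :> R[i].
Proof. by rewrite /cexp /= expR0 cos0 sin0 mul1r. Qed.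

Lemma cexpD (u v : R[i]) : cexp (u + v) = cexp u * cexp v.
Proof.
rewrite /cexp ReD ImD expRD cosD sinD rmorphM /=.
rewrite mulrACA; congr (_ * _).
by apply/eqP; rewrite eq_complex /= addrC [X in _ && (_ == X)]addrC !eqxx.
Qed.

Lemma cderive_cexp l :
  cderive (fun x => cexp (l * x%:C)) (fun x => l * cexp (l * x%:C)).
Proof.
case: l => a b.
have E x : cexp ((a +i* b) * x%:C) =
    (expR (a * x))%:C * ((cos (b * x))%:C + 'i%C * (sin (b * x))%:C).
  rewrite /cexp ReM ImM /= !mulr0 subr0 add0r.
  by congr (_ * _); rewrite [LHS]complexE.
have Da c (x : R) : is_derive x (1 : R) (fun y => c * y) c.
  by rewrite -[X in is_derive _ _ _ X]mulr1; exact: is_deriveZ.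
have De : cderive (fun x => (expR (a * x))%:C) (fun x => (a * expR (a * x))%:C).
  apply: cderive_real => x; rewrite mulrC.
  exact: (@is_derive1_comp _ expR (fun y => a * y)).
have Dc : cderive (fun x => (cos (b * x))%:C) (fun x => (- b * sin (b * x))%:C).
  apply: cderive_real => x; rewrite mulNr mulrC -mulNr.
  exact: (@is_derive1_comp _ cos (fun y => b * y)).
have Ds : cderive (fun x => (sin (b * x))%:C) (fun x => (b * cos (b * x))%:C).
  apply: cderive_real => x; rewrite mulrC.
  exact: (@is_derive1_comp _ sin (fun y => b * y)).
apply: cderive_ext (cderiveM De (cderiveD Dc (cderiveZ 'i%C Ds))) => x.
  by rewrite E.
rewrite E [a +i* b]complexE /= !rmorphM rmorphN /=.
(* The imaginary unit becomes a variable [I]; writing - b as I * I * b leaves an identity that holds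
   for every [I]. *)
have := @sqr_i R; rewrite expr2; move: 'i%C => I II.
set ea := (expR _)%:C; set sb := (sin _)%:C; set cb := (cos _)%:C.
rewrite (_ : - b%:C * sb = I * I * b%:C * sb); last by rewrite II; ring.
ring.
Qed.

End ComplexDerivative.

(** * Closure properties, primitives and linear differential equations *)

Section ExponentialPolynomials.
Variable R : realType.
Implicit Types (g e : R -> R[i]) (l w : R[i]).

Lemma exponential_polynomial_ext g e : g =1 e ->
  exponential_polynomial g -> exponential_polynomial e.
Proof. by move=> /funext ->. Qed.

Lemma exponential_polynomial0 : exponential_polynomial (fun _ : R => 0).
Proof.
exists 0%N, (fun=> 0), (fun=> 0%N), (fun=> 0) => x.
by rewrite big_ord0.
Qed.

Lemma exponential_polynomial_monomial w k l :
  exponential_polynomial (fun x : R => w * x%:C ^+ k * cexp (l * x%:C)).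
Proof.
exists 1%N, (fun=> w), (fun=> k), (fun=> l) => x.
by rewrite big_ord1.
Qed.

Lemma exponential_polynomialD g e :
  exponential_polynomial g -> exponential_polynomial e ->
  exponential_polynomial (fun x => g x + e x).
Proof.
move=> [m [c [k [l gE]]]] [m' [c' [k' [l' eE]]]].
pose glue T (u : 'I_m -> T) (v : 'I_m' -> T) (i : 'I_(m + m')) :=
  match fintype.split i with inl i => u i | inr i => v i end.
exists (m + m')%N, (glue _ c c'), (glue _ k k'), (glue _ l l') => x.
rewrite big_split_ord gE eE /=; congr (_ + _); apply: eq_bigr => i _.
  by rewrite /glue -[lshift _ _]/(unsplit (inl i)) unsplitK.
by rewrite /glue -[rshift _ _]/(unsplit (inr i)) unsplitK.
Qed.

Lemma exponential_polynomial_sum n (g : 'I_n -> R -> R[i]) :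
  (forall i, exponential_polynomial (g i)) ->
  exponential_polynomial (fun x => \sum_i g i x).
Proof.
elim: n g => [|n IH] g Eg.
  apply: exponential_polynomial_ext exponential_polynomial0 => x.
  by rewrite big_ord0.
have := exponential_polynomialD
  (IH _ (fun i => Eg (widen_ord (leqnSn n) i))) (Eg ord_max).
by apply: exponential_polynomial_ext => x; rewrite big_ord_recr.
Qed.

Lemma exponential_polynomial_mul_cexp mu g : exponential_polynomial g ->
  exponential_polynomial (fun x => g x * cexp (mu * x%:C)).
Proof.
move=> [m [c [k [l gE]]]]; exists m, c, k, (fun j => l j + mu) => x.
rewrite gE mulr_suml; apply: eq_bigr => j _.
by rewrite mulrDl cexpD mulrA.
Qed.

(** For [l = 0] this is the power rule; otherwise integration by parts lowers [k], and the induction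
    hypothesis supplies the remaining term with coefficient - (w / l) (k + 1). *)
Lemma monomial_primitive k l w : exists2 q, exponential_polynomial q &
  cderive q (fun x : R => w * x%:C ^+ k * cexp (l * x%:C)).
Proof.
have [->|l0] := eqVneq l 0.
  exists (fun x => w / k.+1%:R * x%:C ^+ k.+1 * cexp (0 * x%:C)).
    exact: exponential_polynomial_monomial.
  apply: cderive_ext (cderiveZ (w / k.+1%:R) (@cderive_powX R k)) => x.
    by rewrite mul0r cexp0 mulr1.
  by rewrite mul0r cexp0 mulr1 mulrA divfK // pnatr_eq0.
elim: k w => [|k IH] w.
  exists (fun x => w / l * x%:C ^+ 0 * cexp (l * x%:C)).
    exact: exponential_polynomial_monomial.
  apply: cderive_ext (cderiveZ (w / l) (cderive_cexp l)) => x.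
    by rewrite expr0 mulr1.
  by rewrite expr0 mulr1 mulrA divfK.
have [q Eq Dq] := IH (- (w / l * k.+1%:R)).
exists (fun x => w / l * x%:C ^+ k.+1 * cexp (l * x%:C) + q x).
  by apply: exponential_polynomialD => //; exact: exponential_polynomial_monomial.
have := cderiveD (cderiveZ (w / l) (cderiveM (@cderive_powX R k) (cderive_cexp l))) Dq.
apply: cderive_ext => x; first by rewrite mulrA.
by field.
Qed.

Lemma exponential_polynomial_primitive g : exponential_polynomial g ->
  exists2 q, exponential_polynomial q & cderive q g.
Proof.
move=> [m [c [k [l gE]]]].
have /choice[q Hq] : forall j, exists q, exponential_polynomial q /\
    cderive q (fun x : R => c j * x%:C ^+ k j * cexp (l j * x%:C)).
  by move=> j; have [q] := monomial_primitive (k j) (l j) (c j); exists q.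
exists (fun x => \sum_j q j x).
  by apply: exponential_polynomial_sum => j; exact: (Hq j).1.
have := cderive_sum (fun j => (Hq j).2).
by apply: cderive_ext => x.
Qed.

(** Integrating factor: the derivative of g(x) e^(- l x) is e(x) e^(- l x), which has an exponential
    polynomial [q] as primitive, and the two differ by a constant. *)
Lemma exponential_polynomial_ode1 l g e : exponential_polynomial e ->
  cderive g (fun x => l * g x + e x) -> exponential_polynomial g.
Proof.
move=> Ee Dg.
have expK x : cexp (- l * x%:C) * cexp (l * x%:C) = 1.
  by rewrite -cexpD mulNr addNr cexp0.
have [q Eq Dq] := exponential_polynomial_primitive
  (exponential_polynomial_mul_cexp (- l) Ee).
have Dh := cderiveB (cderiveM Dg (cderive_cexp (- l))) Dq.
have {Dh}/cderive0_cst : cderive (fun x => g x * cexp (- l * x%:C) - q x) (fun=> 0).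
  by apply: cderive_ext Dh => x //; ring.
set w := _ - q 0 => gq.
have Ew : exponential_polynomial (fun x : R => q x + w).
  apply: exponential_polynomialD => //.
  apply: exponential_polynomial_ext (exponential_polynomial_monomial w 0 0) => x.
  by rewrite mul0r cexp0 !mulr1.
apply: exponential_polynomial_ext (exponential_polynomial_mul_cexp l Ew) => x.
by rewrite -(gq x) addrC subrK -mulrA expK mulr1.
Qed.

Lemma linear_ode_exponential_polynomial m (r : R -> 'rV[R]_m) (B : 'M[R]_m)
    (v : 'cV[R[i]]_m) :
    (forall x j, is_derive x (1 : R) (fun t => r t 0 j) ((r x *m B) 0 j)) ->
  exponential_polynomial (fun x => (map_mx (real_complex R) (r x) *m v) 0 0).
Proof.
case: m r B v => [|m] r B v Dr.
  apply: exponential_polynomial_ext exponential_polynomial0 => x.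
  by rewrite mxE big_ord0.
pose Bc := map_mx (real_complex R) B.
pose h (u : 'cV[R[i]]_m.+1) x := (map_mx (real_complex R) (r x) *m u) 0 0.
have Dh u : cderive (h u) (h (Bc *m u)).
  have := cderive_sum (fun j => cderiveZ (u j 0)
    (cderive_real (fun x => Dr x j))).
  apply: cderive_ext => x.
    by rewrite /h mxE; apply: eq_bigr => j _; rewrite mxE mulrC.
  rewrite /h mulmxA -map_mxM mxE; apply: eq_bigr => j _.
  by rewrite [in RHS]mxE mulrC.
(* [h u] solves g' = l g + h ((Bc - l) u), whose inhomogeneous term is killed by the shorter
   list. *)
have killed s : forall u, foldl (fun u l => (Bc - l%:M) *m u) u s = 0 ->
    exponential_polynomial (h u).
  elim: s => [|l s IH] u /= u0.
    apply: exponential_polynomial_ext exponential_polynomial0 => x.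
    by rewrite u0 /h mulmx0 mxE.
  apply: (exponential_polynomial_ode1 (l := l) (IH _ u0)).
  apply: cderive_ext (Dh u) => // x.
  rewrite /h mulmxBl mulmxBr mul_scalar_mx -scalemxAr.
  have split_l (M N : 'M[R[i]]_1) : M 0 0 = l * N 0 0 + (M - l *: N) 0 0.
    by rewrite !mxE; ring.
  exact: split_l.
(* With [s] the list of eigenvalues, the product of the [Bc - l] is the characteristic polynomial at
   [Bc], hence 0, so every [v] is killed. *)
have [s sE] := closed_field_poly_normal (char_poly Bc).
apply: (killed (rev s)); rewrite foldl_rev.
have -> : foldr (fun l u => (Bc - l%:M) *m u) v s =
    horner_mx Bc (\prod_(z <- s) ('X - z%:P)) *m v.
  elim: s {sE} => [|l s IH] /=; first by rewrite big_nil rmorph1 mul1mx.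
  rewrite big_cons rmorphM /= -mulmxE -mulmxA -IH.
  by rewrite rmorphB /= horner_mx_X horner_mx_C.
have := Cayley_Hamilton Bc; rewrite sE (monicP (char_poly_monic _)) scale1r.
by move=> ->; rewrite mul0mx.
Qed.

End ExponentialPolynomials.

Theorem corollary2p4 (R : realType) (n : nat) (f : R -> R)
    (n_ge1 : (1 <= n)%N)
    (f_cont : continuous f)
    (f_det : forall x h : R, \det (hankel_mx n f x h) = 0) :
  exponential_polynomial (fun x : R => (f x)%:C).
Proof.
have [m [a [b [E_unit f_add]]]] := @rank_factorization R R R 0 0
  (fun x y => f (x + y)) n (det_translates f_cont f_det).
have [P P_derive] := continuous_primitive f_cont.
have [B r_ode] := finite_rank_ode P_derive E_unit f_add.
(* Taking y = 0 in [f_add] exhibits [f] as the row of translates times this constant vector. *)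
pose v := invmx (\matrix_(i, j) f (a i + b j)) *m \col_i f (a i + 0).
apply: exponential_polynomial_ext
  (linear_ode_exponential_polynomial (map_mx (real_complex R) v) r_ode) => x.
by rewrite -map_mxM mxE mulmxA -f_add addr0.
Qed.
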